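(* Let $G$ be a finite group, let $H,K$ be subgroups of $G$, and let $Q$ be a probability on $G$ that is a class function, i.e. $Q(s)=Q(t^{-1}st)$ for all $s,t\in G$. Then the process induced on the double coset space $H\backslash G/K$ by the random walk on $G$ driven by $Q$ is a Markov chain, with the following properties. (1) Its transition probabilities are $P(x,y)=Q(HyKx^{-1})$ for $x,y\in H\backslash G/K$. (2) Its stationary distribution is $\pi(x)=|HxK|/|G|$. (3) If $Q(s^{-1})=Q(s)$ for all $s\in G$, then $P$ is reversible with respect to $\pi$: $\pi(x)P(x,y)=\pi(y)P(y,x)$ for all $x,y$. Suppose moreover that $Q$ is concentrated on a single conjugacy class $\mathcal C$, that is, $Q(s)=1/|\mathcal C|$ for $s\in\mathcal C$ and $Q(s)=0$ otherwise. Then: (4) The eigenvalues of $P$ are among the set $\left\{\chi_\lambda(\mathcal C)/\chi_\lambda(1)\right\}_{\lambda\in\widehat G}$. (5) The multiplicity of $\chi_\lambda(\mathcal C)/\chi_\lambda(1)$ is $m_\lambda=\langle\chi_\lambda|_H,1\rangle\cdot\langle\chi_\lambda|_K,1\rangle$. (6) For any time $\ell>0$, $$\sum_{x\in H\backslash G/K}\pi(x)\,\|P_x^\ell-\pi\|_{TV}^2\le\frac14\sum_{\lambda\ne 1}m_\lambda\left|\frac{\chi_\lambda(\mathcal C)}{\chi_\lambda(1)}\right|^{2\ell}.$$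
   Context: The double cosets $H\backslash G/K$ are the classes of the equivalence relation $s\sim t\iff t=hsk$ for some $h\in H$, $k\in K$; a double coset $HxK$ is denoted by a chosen representative $x\in G$. For a subset $A\subseteq G$, $Q(A)=\sum_{s\in A}Q(s)$. The random walk on $G$ driven by $Q$ moves from $x$ to $gx$ with $g$ chosen from $Q$, so its one-step transition probability from $x$ to $y$ is $Q(yx^{-1})$; the induced process records the double coset containing the current position. $\widehat G$ is the set of irreducible complex representations of $G$, $\chi_\lambda$ is the character of $\lambda\in\widehat G$, $\chi_\lambda(\mathcal C)$ is its value on $\mathcal C$, and $\lambda=1$ is the trivial representation. $\langle\chi_\lambda|_H,1\rangle$ is the number of times the trivial representation of $H$ appears in the restriction of $\chi_\lambda$ to $H$ (similarly for $K$). Multiplicities are counted per $\lambda$: if several $\lambda$ give the same number, their $m_\lambda$ are added. $P_x^\ell=P^\ell(x,\cdot)$ is the distribution after $\ell$ steps from $x$ ($\ell$ an integer), and $\|\mu-\nu\|_{TV}=\frac12\sum_y|\mu(y)-\nu(y)|$. *)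

(* Defs.v *)
From HB Require Import structures.
From mathcomp Require Import all_boot all_order all_algebra all_fingroup.
From mathcomp Require Import mxrepresentation.
From mathcomp Require Import reals.
From mathcomp Require Import complex.

Set Implicit Arguments.
Unset Strict Implicit.
Unset Printing Implicit Defensive.

Import Order.TTheory GRing.Theory Num.Theory GroupScope.
Local Open Scope ring_scope.

Section FiniteProbability.
Variable R : realType.

Definition is_prob (T : finType) (p : T -> R) : Prop :=
  (forall t, 0 <= p t) /\ \sum_t p t = 1.

Definition tv_dist (T : finType) (mu nu : T -> R) : R :=
  2^-1 * \sum_t `|mu t - nu t|.

Definition stationary (T : finType) (p : T -> R) (P : T -> T -> R) : Prop :=
  is_prob p /\ forall y, \sum_x p x * P x y = p y.

Definition reversible (T : finType) (p : T -> R) (P : T -> T -> R) : Prop :=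
  forall x y, p x * P x y = p y * P y x.

(* [law [:: y_0; ...; y_n]] stands for Pr(Y_0 = y_0, ..., Y_n = y_n): a process
   (Y_n) is given by its finite-dimensional distributions.  The second clause
   is Pr(Y_{n+1} = y | Y_0, ..., Y_n = x) = P x y, required for every history
   of positive probability. *)
Definition markov_chain (T : finType) (law : seq T -> R) (P : T -> T -> R)
    : Prop :=
  (forall x, is_prob (P x)) /\
  (forall (s : seq T) (x y : T), 0 < law (rcons s x) ->
     law (rcons (rcons s x) y) / law (rcons s x) = P x y).

End FiniteProbability.

Section DoubleCosets.
Variables (G : finGroupType) (H K : {group G}).

Definition dcosets : {set {set G}} := [set (H :* x * K)%g | x in [set: G]].

(* The space H\G/K, enumerated so that functions on pairs of double cosets
   are matrices; [dcoset i] is the double coset with index [i]. *)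
Definition dcoset_space := 'I_#|dcosets|.

Definition dcoset (i : dcoset_space) : {set G} := enum_val i.

End DoubleCosets.

Section Walk.
Variables (R : realType) (G : finGroupType).

(* The law of (X_0, ..., X_n) for the random walk with X_0 drawn from mu and
   one-step transition probabilities Q(y x^-1). *)
Fixpoint walk_steps (Q : G -> R) (x : G) (w : seq G) : R :=
  if w is y :: w' then Q (y * x^-1)%g * walk_steps Q y w' else 1.

Definition walk_law (mu Q : G -> R) (w : seq G) : R :=
  if w is x :: w' then mu x * walk_steps Q x w' else 1.

(* The law of (H X_0 K, ..., H X_n K): the sum over all paths of the walk that
   visit the prescribed double cosets. *)
Definition induced_law (H K : {group G}) (mu Q : G -> R)
    (s : seq (dcoset_space H K)) : R :=
  \sum_(w : (size s).-tuple G | all2 (fun x i => x \in dcoset i) w s)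
     walk_law mu Q w.

Definition dcoset_pi (H K : {group G}) (i : dcoset_space H K) : R :=
  #|dcoset i|%:R / #|G|%:R.

End Walk.

(* Complex representations are taken over the complex numbers R[i]; the
   library's 'chi_i and '[_, _] are only available over algC. *)
Section Representations.
Variables (R : realType) (G : finGroupType).
Local Notation C := R[i].

Definition irreps (L : {group G}) : irrType C L :=
  DecSocleType (regular_repr C L).

Definition chi (lambda : irreps [set: G]) (x : G) : C :=
  \tr (irr_repr lambda x).

Definition chi_ratio (lambda : irreps [set: G]) (x : G) : C :=
  chi lambda x / chi lambda 1%g.

(* The number of times the trivial representation occurs in rL. *)
Definition triv_mult (L : {group G}) (n : nat) (rL : mx_representation C L n)
    : nat :=
  (\sum_(W : DecSocleType rL
        | irr_comp (irreps L) (socle_repr W) == [1 (irreps L)]%irr)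
     socle_mult W)%N.

Definition res_triv_mult (L : {group G}) (lambda : irreps [set: G]) : nat :=
  triv_mult (subg_repr (irr_repr lambda) (subsetT L)).

Definition m_mult (H K : {group G}) (lambda : irreps [set: G]) : nat :=
  (res_triv_mult H lambda * res_triv_mult K lambda)%N.

End Representations.

Notation complex_mx P := (map_mx (real_complex _) P).

(* Main.v *)
Require Import Defs.
From HB Require Import structures.
From mathcomp Require Import all_boot all_order all_algebra all_fingroup.
From mathcomp Require Import pgroup mxrepresentation.
From mathcomp Require Import reals.
From mathcomp Require Import complex ring.

(** Every class function f on G acts on functions of the double cosets D_i by
    the kernel [dcoset_mx f], whose (i, j) entry is the sum of f (y x^-1) over y
    in D_j; because f is central this sum is the same for every x in D_i, which
    is exactly Dynkin's lumping criterion, so for f = Q the projected walk is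
    Markov with kernel [dcoset_mx Q] ([induced_markov]).

    The map f |-> [dcoset_mx f] turns convolution into matrix product
    ([dcoset_mxM]).  It is the action of the centre of the group algebra on the
    bi-invariant functions.  Hence the central idempotents
    e_l(s) = (n_l / |G|) chi_l(s^-1) are sent to orthogonal idempotents E_l with
    sum 1 ([irr_proj_resolution]), and by Schur's lemma every class function
    becomes a combination of them ([dcoset_mx_spectral]); when Q is uniform on
    the class of c, the coefficient of E_l is chi_l(c) / chi_l(1).  This gives
    the eigenvalues, and the multiplicity contributed by l is the rank of E_l,
    that is its trace.  Averaging over H x K computes the trace of any kernel
    ([mxtrace_dcoset_mx]), and for e_l Schur's lemma factors it as the product
    of the means of chi_l over H and over K, namely m_l
    ([mxtrace_irr_proj], [triv_mult_average]).

    For the mixing bound, Cauchy-Schwarz bounds the squared total variation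
    distance by a quarter of the chi-square distance, whose pi-average is
    tr (P^l P'^l) - 1, with P' the pi-adjoint of P ([avg_tv_bound]).  As P' is the
    kernel of s |-> Q (s^-1), its coefficients are the complex conjugates of those
    of P ([central_valueV]), so the trace is the sum of
    m_l |chi_l(c) / chi_l(1)|^(2l), and the trivial representation contributes
    the 1 that is subtracted. *)
Set Implicit Arguments.
Unset Strict Implicit.
Unset Printing Implicit Defensive.

Import Order.TTheory GRing.Theory Num.Theory GroupScope.
Local Open Scope ring_scope.

(** * Spectral resolutions of matrices *)

Section Spectral.
Variable F : numFieldType.

(** In a rank factorisation E = c d, idempotence forces d c to be the identity of
    size the rank. *)
Lemma mxtrace_idem n (E : 'M[F]_n) : E *m E = E -> \tr E = (\rank E)%:R.
Proof.
move=> EE; have /row_fullP[B BC] := col_base_full E.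
have /row_freeP[B' RB'] := row_base_free E.
move: (mulmx_base E) BC RB'.
move: (\rank E) (col_base E) (row_base E) B B' => r c d B B' cd BC RB'.
have dc1 : d *m c = 1%:M.
  rewrite -[LHS]mul1mx -BC -[LHS]mulmx1 -RB' -!mulmxA.
  by rewrite !(mulmxA c d) cd (mulmxA E) EE -cd -!mulmxA RB' mulmx1 BC.
by rewrite -cd mxtrace_mulC dc1 mxtrace1.
Qed.

Definition spectral_resolution (I : finType) n (E : I -> 'M[F]_n) :=
  (forall i j, E i *m E j = if i == j then E i else 0) /\ \sum_i E i = 1%:M.

Lemma spectral_resolution_eigen (I : finType) n (E : I -> 'M[F]_n)
    (d : I -> F) i :
  spectral_resolution E ->
  E i *m (\sum_j d j *: E j) = d i *: E i.
Proof.
case=> ort _; rewrite mulmx_sumr (bigD1 i) //= -scalemxAr ort eqxx.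
rewrite big1 ?addr0 // => j ne.
by rewrite -scalemxAr ort eq_sym (negPf ne) scaler0.
Qed.

Lemma spectral_resolution_eigen_col (I : finType) n (E : I -> 'M[F]_n)
    (d : I -> F) i :
  spectral_resolution E ->
  (\sum_j d j *: E j) *m E i = d i *: E i.
Proof.
case=> ort _; rewrite mulmx_suml (bigD1 i) //= -scalemxAl ort eqxx.
by rewrite big1 ?addr0 // => j ne; rewrite -scalemxAl ort (negPf ne) scaler0.
Qed.

Lemma spectral_resolution_exp (I : finType) n (E : I -> 'M[F]_n)
    (d : I -> F) l :
  spectral_resolution E ->
  (\sum_i d i *: E i) ^+ l = \sum_i d i ^+ l *: E i.
Proof.
move=> res; elim: l => [|l IHl].
  rewrite expr0 -[LHS](proj2 res); apply: eq_bigr => i _.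
  by rewrite expr0 scale1r.
rewrite exprSr IHl mulr_suml; apply: eq_bigr => i _.
rewrite -[LHS]/(_ *m _) -scalemxAl spectral_resolution_eigen //.
by rewrite scalerA exprSr.
Qed.

Lemma spectral_resolution_eigenvalue (I : finType) n (E : I -> 'M[F]_n)
    (d : I -> F) a :
  spectral_resolution E -> eigenvalue (\sum_i d i *: E i) a ->
  exists2 i, E i != 0 & a = d i.
Proof.
move=> res /eigenvalueP[v vA v0].
have /existsP[i vEi] : [exists i, v *m E i != 0].
  apply: contraNT v0; rewrite negb_exists => /forallP vE0.
  rewrite -[v]mulmx1 -(proj2 res) mulmx_sumr big1 // => i _.
  by apply/eqP; move: (vE0 i); rewrite negbK.
exists i; first by apply: contraNneq vEi => ->; rewrite mulmx0.
apply: (scalerI_nz vEi) || idtac.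
have : (a - d i) *: (v *m E i) = 0.
  rewrite scalerBl scalemxAl -vA -mulmxA spectral_resolution_eigen_col //.
  by rewrite -scalemxAr subrr.
by move/eqP; rewrite scaler_eq0 (negPf vEi) orbF subr_eq0 => /eqP.
Qed.

(** The eigenspace for a is the row space of the idempotent S that sums the E i
    with d i = a, so its dimension is the trace of S. *)
Lemma spectral_resolution_rank (I : finType) n (E : I -> 'M[F]_n)
    (d : I -> F) a :
  spectral_resolution E ->
  (\rank (eigenspace (\sum_i d i *: E i) a))%:R =
  \sum_(i | d i == a) \tr (E i) :> F.
Proof.
move=> res; set A := \sum_i _; pose S := \sum_(i | d i == a) E i.
have SE i : S *m E i = if d i == a then E i else 0.
  rewrite /S mulmx_suml; case: ifP => [di|/negP di].
    rewrite (bigD1 i) //= (proj1 res) eqxx big1 ?addr0 // => j /andP[_ ne].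
    by rewrite (proj1 res) (negPf ne).
  apply: big1 => j /eqP dj; rewrite (proj1 res); case: eqP => // ji.
  by case: di; rewrite -ji dj.
have SS : S *m S = S.
  by rewrite {2}/S mulmx_sumr; apply: eq_bigr => i di; rewrite SE di.
have eqS : (eigenspace A a :=: S)%MS.
  apply/eqmxP/andP; split; last first.
    apply/eigenspaceP; rewrite scaler_sumr mulmx_suml.
    apply: eq_bigr => i /eqP <-.
    exact: spectral_resolution_eigen.
  have /eigenspaceP := submx_refl (eigenspace A a).
  set V := eigenspace A a => VA.
  suff -> : V = V *m S by apply: submxMl.
  rewrite -[LHS]mulmx1 -(proj2 res) (bigID (fun i => d i == a)) /= mulmxDr.
  rewrite [X in _ + X]mulmx_sumr [X in _ + X]big1 ?addr0 // => i nedi.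
  have : (d i - a) *: (V *m E i) = 0.
    rewrite scalerBl [a *: _]scalemxAl -VA -mulmxA.
    by rewrite spectral_resolution_eigen_col // -scalemxAr subrr.
  by move/eqP; rewrite scaler_eq0 subr_eq0 (negPf nedi) /= => /eqP.
by rewrite eqS -mxtrace_idem // /S raddf_sum.
Qed.

Lemma char_poly_similar n (P A B : 'M[F]_n) :
  P \in unitmx -> P *m A = B *m P -> char_poly A = char_poly B.
Proof.
move=> uP PA; rewrite /char_poly.
have uP' : map_mx polyC P \in unitmx by rewrite map_unitmx.
have PC : map_mx polyC P *m char_poly_mx A = char_poly_mx B *m map_mx polyC P.
  rewrite /char_poly_mx mulmxBr mulmxBl -!map_mxM PA; congr (_ - _).
  exact: scalar_mxC.
have := congr1 determinant PC; rewrite !det_mulmx mulrC => /mulIf; apply.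
by rewrite det_map_mx polyC_eq0 -unitfE -unitmxE.
Qed.

Lemma mup_prod_XsubC (I : finType) (d : I -> F) a :
  mup a (\prod_i ('X - (d i)%:P)) = (\sum_(i | d i == a) 1)%N.
Proof.
rewrite [RHS]big_mkcond /=.
have [_ //]: \prod_i ('X - (d i)%:P) != 0 /\
   mup a (\prod_i ('X - (d i)%:P)) = (\sum_i if d i == a then 1 else 0)%N.
apply: (big_rec2 (fun p m => p != 0 /\ mup a p = m)).
  split; first exact: oner_neq0.
  by rewrite mupNroot // rootE hornerC oner_eq0.
move=> i m p _ [p0 <-]; split; first by rewrite mulf_neq0 ?polyXsubC_eq0.
rewrite mupM ?polyXsubC_eq0 //; congr addn.
by rewrite -[_ - _]expr1 mup_XsubCX eq_sym; case: eqP.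
Qed.

(** The eigenspaces fill the space, so the matrix is similar to some diagonal D.
    Both multiplicities are invariant under similarity, and for D they both count
    the diagonal entries equal to a. *)
Lemma spectral_resolution_mup (I : finType) n (E : I -> 'M[F]_n)
    (d : I -> F) a :
  spectral_resolution E ->
  mup a (char_poly (\sum_i d i *: E i)) =
  \rank (eigenspace (\sum_i d i *: E i) a).
Proof.
move=> res; set A := \sum_i _.
have /diagonalizablePeigen[P uP /(diagonalizable_forPex)[D /(simmxP uP) PA]] :
    exists2 rs, uniq rs & (\sum_(r <- rs) eigenspace A r :=: 1%:M)%MS.
  exists (undup (codom d)); first exact: undup_uniq.
  apply/eqmxP; rewrite submx1 /= -(proj2 res); apply: summx_sub => i _.
  rewrite (big_rem (d i)) /=; last by rewrite mem_undup codom_f.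
  apply: submx_trans (addsmxSl _ _).
  by apply/eigenspaceP; apply: spectral_resolution_eigen.
rewrite (char_poly_similar uP PA) char_poly_trig; last first.
  by rewrite diag_mx_is_trig.
rewrite (eq_bigr (fun i => 'X - (D 0 i)%:P)); last first.
  by move=> i _; rewrite mxE eqxx.
have resD : spectral_resolution (fun i => @delta_mx F n n i i).
  split=> [i j|]; last first.
    apply/matrixP=> i j; rewrite summxE (bigD1 i) //= !mxE eqxx /=.
    by rewrite big1 ?addr0 1?eq_sym // => k ki; rewrite mxE eq_sym (negPf ki).
  by rewrite mul_delta_mx_cond; case: eqP => [->|].
have DE : diag_mx D = \sum_i D 0 i *: delta_mx i i by rewrite diag_mx_sum_delta.
have tr1 i : \tr (@delta_mx F n n i i) = 1%N%:R.
  rewrite /mxtrace (bigD1 i) //= mxE !eqxx big1 ?addr0 // => j ne.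
  by rewrite mxE (negPf ne).
have rkD : \rank (eigenspace (diag_mx D) a) = (\sum_(i | D 0%R i == a) 1)%N.
  apply/eqP; rewrite -(eqr_nat F) DE spectral_resolution_rank // natr_sum.
  by apply/eqP/eq_bigr => i _; rewrite tr1.
rewrite mup_prod_XsubC -rkD.
have PD : invmx P *m diag_mx D = A *m invmx P.
  by rewrite -[LHS](mulmxK uP) -(mulmxA _ _ P) -PA mulmxA mulVmx // mul1mx.
have freeP : row_free P by rewrite row_free_unit.
have freeP' : row_free (invmx P) by rewrite row_free_unit unitmx_inv.
apply/eqP; rewrite eqn_leq; apply/andP; split.
  rewrite -(mxrankMfree (eigenspace (diag_mx D) a) freeP).
  apply: mxrankS; apply/eigenspaceP.
  by rewrite -mulmxA PA mulmxA (eigenspaceP (submx_refl _)) scalemxAl.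
rewrite -(mxrankMfree (eigenspace A a) freeP').
apply: mxrankS; apply/eigenspaceP.
by rewrite -mulmxA PD mulmxA (eigenspaceP (submx_refl _)) scalemxAl.
Qed.

End Spectral.

(** * Characters over a numeric closed field *)

Section Reps.
Variable C : numClosedFieldType.

Lemma pchar_num_group (gT : finGroupType) (G : {group gT}) :
  [pchar C]^'.-group G.
Proof. by apply/pgroupP=> p _; rewrite inE /= pchar_num. Qed.

Lemma card_group_neq0 (gT : finGroupType) (G : {group gT}) : #|G|%:R != 0 :> C.
Proof. by rewrite pnatr_eq0 -lt0n cardG_gt0. Qed.

Section OneRep.
Variables (gT : finGroupType) (G : {group gT}) (n : nat).
Variable rG : mx_representation C G n.

(** Schur's lemma, with the scalar read off the trace. *)
Lemma irr_cent_scalar A :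
  mx_irreducible rG -> centgmx rG A -> A = (\tr A / n%:R)%:M.
Proof.
move=> irrG cA.
have n0 : n%:R != 0 :> C by case/mx_irrP: irrG; rewrite pnatr_eq0 -lt0n.
have /mx_abs_irr_cent_scalar/(_ _ cA)/is_scalar_mxP[c ->] :
  mx_absolutely_irreducible rG by apply: group_closure_closed_field.
by rewrite mxtrace_scalar -(mulr_natr c) mulfK.
Qed.

Lemma class_sum_scalar (f : gT -> C) : mx_irreducible rG ->
  {in G &, forall s t, f (s ^ t)%g = f s} ->
  \sum_(s in G) f s *: rG s = ((\sum_(s in G) f s * \tr (rG s)) / n%:R)%:M.
Proof.
move=> irrG fJ; rewrite [LHS]irr_cent_scalar //.
  rewrite raddf_sum /=; congr (_ / _)%:M.
  by apply: eq_bigr => s _; rewrite mxtraceZ.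
apply/centgmxP => x Gx; rewrite mulmx_suml mulmx_sumr.
rewrite [RHS](reindex_inj (conjg_inj x)) /=.
apply: eq_big => [s|s Gs]; first by rewrite groupJr.
by rewrite -scalemxAl -scalemxAr fJ // -!repr_mxM ?groupJ // -conjgC.
Qed.

(** The sum of the conjugates of rG t commutes with the representation, so it is
    a scalar matrix and its trace determines it. *)
Lemma trace_class_average s t : mx_irreducible rG -> s \in G -> t \in G ->
  \sum_(x in G) \tr (rG (s * t ^ x)%g) =
  #|G|%:R / n%:R * (\tr (rG s) * \tr (rG t)).
Proof.
move=> irrG Gs Gt; pose A := \sum_(x in G) rG (t ^ x)%g.
have -> : \sum_(x in G) \tr (rG (s * t ^ x)%g) = \tr (rG s *m A).
  rewrite mulmx_sumr raddf_sum; apply: eq_bigr => x Gx.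
  by rewrite /= -repr_mxM ?groupJ.
have trA : \tr A = #|G|%:R * \tr (rG t).
  rewrite raddf_sum mulr_natl -sumr_const; apply: eq_bigr => x Gx /=.
  rewrite conjgE !repr_mxM ?groupM ?groupV // mxtrace_mulC -mulmxA.
  by rewrite repr_mxV // mulmxV ?repr_mx_unit // mulmx1.
rewrite (irr_cent_scalar irrG (A := A)); last first.
  apply/centgmxP => x Gx; rewrite mulmx_suml mulmx_sumr.
  rewrite [RHS](reindex_inj (mulIg x)) /=.
  apply: eq_big => [y|y Gy]; first by rewrite groupMr.
  by rewrite -!repr_mxM ?groupJ ?groupM // conjgM -conjgC.
rewrite mul_mx_scalar mxtraceZ trA.
by rewrite -!mulrA; congr (_ * _); rewrite mulrCA [\tr (rG t) * _]mulrC.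
Qed.

(** Unitarity: S, the sum over G of the Gram matrices of the rG g, is an
    invariant positive definite Hermitian form, so rG x^-1 is conjugate, through
    S, to the adjoint of rG x. *)
Lemma mxtrace_reprV x : x \in G -> \tr (rG x^-1%g) = (\tr (rG x))^*.
Proof.
move=> Gx; pose star m p (A : 'M[C]_(m, p)) : 'M_(p, m) := map_mx Num.conj A^T.
have starM m p q (A : 'M_(m, p)) (B : 'M_(p, q)) :
  star _ _ (A *m B) = star _ _ B *m star _ _ A.
  by rewrite /star trmx_mul map_mxM.
pose S := \sum_(g in G) rG g *m star _ _ (rG g).
have SxE : rG x *m S *m star _ _ (rG x) = S.
  rewrite mulmx_sumr mulmx_suml [RHS](reindex_inj (mulgI x)) /=.
  apply: eq_big => [g|g Gg]; first by rewrite groupMl.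
  by rewrite repr_mxM // starM !mulmxA.
have sq_ge0 m (v : 'rV[C]_m) : 0 <= (v *m star _ _ v) 0 0.
  by rewrite mxE sumr_ge0 // => i _; rewrite !mxE mul_conjC_ge0.
(* The term g = 1 alone makes v S v^* vanish only for v = 0. *)
have uS : S \in unitmx.
  rewrite -row_free_unit -kermx_eq0; apply/rowV0P => v /sub_kermxP vS0.
  have : (v *m S *m star _ _ v) 0 0 = 0 by rewrite vS0 mul0mx mxE.
  rewrite mulmx_sumr mulmx_suml summxE => /eqP.
  rewrite psumr_eq0 => [/allP/(_ 1%g)|g _]; last first.
    by rewrite mulmxA -mulmxA -starM sq_ge0.
  rewrite mem_index_enum group1 repr_mx1 => /(_ isT) /=.
  rewrite mul1mx /star trmx1 map_mx1 mulmx1 mxE psumr_eq0; last first.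
    by move=> i _; rewrite !mxE mul_conjC_ge0.
  move/allP => v0; apply/rowP => i; rewrite mxE.
  have := v0 i (mem_index_enum _); rewrite /= !mxE mul_conjC_eq0.
  by move/eqP.
have xVE : S *m star _ _ (rG x) = rG x^-1%g *m S.
  by rewrite -[in RHS]SxE !mulmxA -repr_mxM ?groupV // mulVg repr_mx1 mul1mx.
rewrite -[rG x^-1%g](mulmxK uS) -xVE mxtrace_mulC mulmxA mulVmx // mul1mx.
by rewrite /star -map_trmx mxtrace_tr trace_map_mx.
Qed.


End OneRep.

Section Irr.
Variables (gT : finGroupType) (G : {group gT}) (sG : irrType C G).
Local Notation chi i x := (\tr (irr_repr (i : sG) x)).
Local Notation n_ i := (irr_degree (i : sG)).

Lemma mxtrace_regularE x : x \in G ->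
  \tr (regular_repr C G x) = #|G|%:R *+ (x == 1%g).
Proof.
move=> Gx; have [-> | ntx] := eqVneq x 1%g.
  by rewrite repr_mx1 mxtrace1.
rewrite [LHS]big1 // => i _; rewrite 2!mxE /=.
rewrite -(inj_eq enum_val_inj) gring_indexK ?groupM ?enum_valP //.
by rewrite eq_mulVg1 mulKg (negbTE ntx).
Qed.

Lemma sum_irr_regular x : x \in G ->
  \sum_i (n_ i)%:R * chi i x = #|G|%:R *+ (x == 1%g).
Proof.
move=> Gx; rewrite -mxtrace_regularE //.
rewrite (mxtrace_regular_pchar sG (pchar_num_group G)) //; last first.
  exact: group_closure_closed_field.
by apply: eq_bigr => i _; rewrite mulr_natl.
Qed.

(** The coefficients, in the group algebra, of the central idempotent of i. *)
Definition irr_idem i x : C := (n_ i)%:R / #|G|%:R * chi i x^-1%g.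

(** The Wedderburn idempotent e of i acts as required on every irreducible
    representation; evaluating the regular character at x^-1 e in two ways shows
    that its coefficient at x is [irr_idem i x]. *)
Lemma irr_idem_op i j :
  \sum_(x in G) irr_idem i x *: irr_repr j x = (i == j)%:R%:M.
Proof.
have F'G := pchar_num_group G.
set e := Wedderburn_id i.
have [a def_e] : exists a, e = \sum_(x in G) a x *: regular_repr C G x.
  have /envelop_mxP[a ->] : (e \in group_ring C G)%MS; last by exists a.
  have : (e \in Wedderburn_subring i)%MS by apply: Wedderburn_id_mem.
  by rewrite genmxE mem_sub_gring => /andP[].
have op_e k : \sum_(x in G) a x *: irr_repr k x = (i == k)%:R%:M.
  transitivity (gring_op (irr_repr k) e).
    rewrite def_e linear_sum; apply: eq_bigr => x Gx.
    by rewrite linearZ /= gring_opG.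
  have [<-|ne] := eqVneq i k; first by rewrite op_Wedderburn_id_pchar.
  rewrite (irr_repr'_op0_pchar F'G ne) ?Wedderburn_id_mem //.
  by rewrite raddf0.
suff aE x : x \in G -> irr_idem i x = a x.
  by rewrite -op_e; apply: eq_bigr => x Gx; rewrite aE.
move=> Gx; apply: (mulfI (card_group_neq0 G)).
rewrite /irr_idem mulrA (mulrCA _ (n_ i)%:R) mulfV ?card_group_neq0 // mulr1.
transitivity (\sum_k (n_ k)%:R *
    \tr (irr_repr k x^-1%g *m \sum_(y in G) a y *: irr_repr k y)).
  rewrite (bigD1 i) //= op_e eqxx mulmx1 big1 ?addr0 // => k ne.
  by rewrite op_e eq_sym (negPf ne) raddf0 mulmx0 mxtrace0 mulr0.
transitivity (\sum_(y in G) a y * \sum_k (n_ k)%:R * chi k (x^-1 * y)%g).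
  under [RHS]eq_bigr do rewrite mulr_sumr; rewrite exchange_big /=.
  apply: eq_bigr => k _; rewrite mulmx_sumr raddf_sum mulr_sumr.
  apply: eq_bigr => y Gy; rewrite /= -scalemxAr mxtraceZ mulrCA.
  by rewrite repr_mxM ?groupV.
rewrite (bigD1 x) //= sum_irr_regular ?groupM ?groupV // mulVg eqxx mulr1n.
rewrite big1 ?addr0 1?mulrC // => y /andP[Gy ne].
rewrite sum_irr_regular ?groupM ?groupV //.
by rewrite -eq_mulVg1 eq_sym (negPf ne) mulr0.
Qed.

(** The idempotent of the trivial representation is the constant 1 / |G|, so the
    mean of chi_i is the trace of its action in i. *)
Lemma sum_irr_repr_principal i :
  \sum_(x in G) chi i x = #|G|%:R * (i == [1 sG]%irr)%:R.
Proof.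
have idem1 x : x \in G -> irr_idem [1 sG]%irr x = #|G|%:R^-1.
  move=> Gx; rewrite /irr_idem irr1_repr ?groupV //.
  by rewrite mxtrace1 degree_irr1 mulr1 div1r.
have /(congr1 (fun A => #|G|%:R * \tr A)) := irr_idem_op [1 sG]%irr i.
rewrite raddf_sum mulr_sumr mxtrace_scalar /= => eq1.
transitivity (\sum_(x in G)
    #|G|%:R * \tr (irr_idem [1 sG]%irr x *: irr_repr i x)).
  apply: eq_bigr => x Gx; rewrite mxtraceZ idem1 // mulrA mulfV ?mul1r //.
  exact: card_group_neq0.
rewrite eq1 eq_sym; have [->|_] := eqVneq; last by rewrite mul0rn.
by rewrite degree_irr1.
Qed.

End Irr.

End Reps.

(** Decompose rL into irreducibles: a trivial constituent has mean character 1,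
    any other one has mean character 0. *)
Lemma triv_mult_average (R : realType) (gT : finGroupType) (L : {group gT}) n
    (rL : mx_representation R[i] L n) :
  (triv_mult rL)%:R = #|L|%:R^-1 * \sum_(x in L) \tr (rL x).
Proof.
have F'L := pchar_num_group R[i] L.
pose sL := DecSocleType rL.
have tr_rL x : x \in L ->
    \tr (rL x) = \sum_(W : sL) \tr (socle_repr W x) *+ socle_mult W.
  move=> Lx; have soc1 : (Socle sL :=: 1%:M)%MS.
    by rewrite reducible_Socle1 //; apply: mx_Maschke_pchar.
  by rewrite -(mxtrace_submod1 (Socle_module sL) soc1) // mxtrace_Socle.
rewrite (eq_bigr _ tr_rL) exchange_big mulr_sumr natr_sum /=.
rewrite [LHS]big_mkcond /=; apply: eq_bigr => W _.
have simW := rsim_irr_comp_pchar (irreps R L) F'L (socle_irr W).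
pose i := irr_comp (irreps R L) (socle_repr W).
transitivity (#|L|%:R^-1 *
    ((\sum_(x in L) \tr (irr_repr i x)) *+ socle_mult W)).
  rewrite sum_irr_repr_principal -mulrnAr mulKf ?card_group_neq0 //.
  by case: eqP => _; rewrite ?mul0rn.
rewrite sumrMnl; congr (_ * (_ *+ _)); apply: eq_bigr => x Lx.
exact/esym/(mxtrace_rsim simW).
Qed.

(** * Kernels on the double cosets *)

Section DC.
Variables (G : finGroupType) (H K : {group G}).
Local Notation I := (dcoset_space H K).

Lemma mem_dcosetP (x y : G) :
  reflect (exists h k, [/\ h \in H, k \in K & y = (h * x * k)%g])
          (y \in (H :* x * K)%g).
Proof.
apply: (iffP mulsgP) => [[u k /rcosetP[h Hh ->] Kk ->]|[h [k [Hh Kk ->]]]].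
  by exists h, k.
by exists (h * x)%g k => //; apply/rcosetP; exists h.
Qed.

Lemma dcoset_eq (x y : G) :
  y \in (H :* x * K)%g -> (H :* y * K)%g = (H :* x * K)%g.
Proof.
case/mem_dcosetP => h [k [Hh Kk ->]].
apply/setP => z; apply/mem_dcosetP/mem_dcosetP => -[h' [k' [Hh' Kk' ->]]].
  by exists (h' * h)%g, (k * k')%g; rewrite !groupM // !mulgA.
exists (h' * h^-1)%g, (k^-1 * k')%g; rewrite !groupM ?groupV //; split=> //.
by rewrite !mulgA mulgKV mulgK.
Qed.

Lemma dcosetE (i : I) x : x \in dcoset i -> dcoset i = (H :* x * K)%g.
Proof.
rewrite /dcoset; have /imsetP[y _ ->] := enum_valP i.
by move/dcoset_eq.
Qed.

Lemma dcoset_neq0 (i : I) : exists x, x \in dcoset i.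
Proof.
have /imsetP[y _ Dy] := enum_valP i; exists y; rewrite /dcoset Dy.
by apply/mem_dcosetP; exists 1%g, 1%g; rewrite !group1 mul1g mulg1.
Qed.

Lemma card_dcoset_gt0 (i : I) : (0 < #|dcoset i|)%N.
Proof. by have [x Dx] := dcoset_neq0 i; apply/card_gt0P; exists x. Qed.

Lemma mem_dcosetM (i : I) h k x : h \in H -> k \in K ->
  ((h * x * k)%g \in dcoset i) = (x \in dcoset i).
Proof.
move=> Hh Kk; apply/idP/idP => /dcosetE ->; apply/mem_dcosetP; last first.
  by exists h, k.
exists h^-1%g, k^-1%g; rewrite !groupV; split=> //.
by rewrite !mulgA mulVg mul1g mulgK.
Qed.

Definition dcoset_of (x : G) : I :=
  enum_rank_in (imset_f (fun x => H :* x * K)%g (in_setT x)) (H :* x * K)%g.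

Lemma dcoset_ofE x i : (dcoset_of x == i) = (x \in dcoset i).
Proof.
have in_dc y : (H :* y * K)%g \in dcosets H K by apply: imset_f; rewrite inE.
apply/eqP/idP => [<-|Dx].
  rewrite /dcoset /dcoset_of enum_rankK_in //; apply/mem_dcosetP.
  by exists 1%g, 1%g; rewrite !group1 mul1g mulg1.
apply: enum_val_inj; rewrite enum_rankK_in //.
by rewrite -(dcosetE Dx).
Qed.

Lemma sum_dcosets (V : nmodType) (F : G -> V) :
  \sum_x F x = \sum_(i : I) \sum_(x in dcoset i) F x.
Proof.
rewrite (partition_big dcoset_of xpredT) //=; apply: eq_bigr => i _.
by apply: eq_bigl => x; rewrite dcoset_ofE.
Qed.

Section Matrix.
Variable F : numFieldType.
Implicit Types f g : G -> F.

Definition class_fun f := forall s t, f (s ^ t)%g = f s.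

Definition conv f g (t : G) : F := \sum_y f (t * y^-1)%g * g y.

(** Averaging over x in D_i gives the two double cosets the same role, so that
    the adjoint and the trace can be read off; for class functions [dcoset_mxE]
    removes the average. *)
Definition dcoset_mx f : 'M[F]_#|dcosets H K| :=
  \matrix_(i, j) (#|dcoset i|%:R^-1 *
     \sum_(x in dcoset i) \sum_(y in dcoset j) f (y * x^-1)%g).

Lemma class_funC f s t : class_fun f -> f (s * t)%g = f (t * s)%g.
Proof.
by move=> /(_ (t * s)%g s^-1%g) <-; rewrite conjgE invgK !mulgA mulgK.
Qed.

Lemma card_dcoset_neq0 (i : I) : #|dcoset i|%:R != 0 :> F.
Proof. by rewrite pnatr_eq0 -lt0n card_dcoset_gt0. Qed.

Lemma sum_dcosetM (i : I) (h k : G) (f : G -> F) : h \in H -> k \in K ->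
  \sum_(y in dcoset i) f (h * y * k)%g = \sum_(y in dcoset i) f y.
Proof.
move=> Hh Kk; have inj : injective (fun y => h * y * k)%g.
  by move=> y z /mulIg/mulgI.
rewrite [RHS](reindex_inj inj) /=; apply: eq_bigl => y.
by rewrite mem_dcosetM.
Qed.

(** The lumping criterion: for z = h x k one has f (y z^-1) = f (h^-1 y k^-1 x^-1)
    since f is central, and y |-> h^-1 y k^-1 permutes D_j. *)
Lemma dcoset_mxE f (i j : I) x : class_fun f -> x \in dcoset i ->
  dcoset_mx f i j = \sum_(y in dcoset j) f (y * x^-1)%g.
Proof.
move=> cf Dx; rewrite mxE.
rewrite (eq_bigr (fun=> \sum_(y in dcoset j) f (y * x^-1)%g)); last first.
  move=> z; rewrite (dcosetE Dx) => /mem_dcosetP[h [k [Hh Kk ->]]].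
  have Hh' := groupVr Hh; have Kk' := groupVr Kk.
  rewrite -[RHS](sum_dcosetM _ _ Hh' Kk'); apply: eq_bigr => y _.
  by rewrite !invMg !mulgA class_funC // !mulgA.
by rewrite sumr_const -(mulr_natl (\sum_(y in _) _)) mulKf ?card_dcoset_neq0.
Qed.

(** The entry of the second factor at j may be computed from any y in D_j, so
    the sum over the intermediate double coset becomes a sum over G. *)
Lemma dcoset_mxM f g : class_fun f -> class_fun g ->
  dcoset_mx f *m dcoset_mx g = dcoset_mx (conv g f).
Proof.
move=> cf cg; have cgf : class_fun (conv g f).
  move=> s t; rewrite /conv [LHS](reindex_inj (conjg_inj t)) /=.
  by apply: eq_bigr => y _; rewrite -conjVg -conjMg cf cg.
apply/matrixP => i k; rewrite mxE.
have [x Dx] := dcoset_neq0 i; rewrite (dcoset_mxE _ cgf Dx).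
transitivity (\sum_y f (y * x^-1)%g * \sum_(z in dcoset k) g (z * y^-1)%g).
  rewrite sum_dcosets; apply: eq_bigr => j _.
  rewrite (dcoset_mxE _ cf Dx) mulr_suml; apply: eq_bigr => y Dy.
  by rewrite (dcoset_mxE _ cg Dy).
rewrite /conv exchange_big (reindex_inj (mulIg x)) /=.
apply: eq_bigr => y _; rewrite mulr_sumr; apply: eq_bigr => z _.
by rewrite mulgK invMg mulgA mulrC.
Qed.

Lemma dcoset_mx_delta : dcoset_mx (fun x => (x == 1%g)%:R) = 1%:M.
Proof.
apply/matrixP => i j; have [x Dx] := dcoset_neq0 i.
rewrite (dcoset_mxE _ _ Dx) => [|s t]; last by rewrite conjg_eq1.
rewrite (eq_bigr (fun y => (y == x)%:R)) => [|y _]; last by rewrite -eq_mulgV1.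
rewrite mxE; have -> : (i == j) = (x \in dcoset j).
  by move: Dx; rewrite -!dcoset_ofE => /eqP ->.
have [Dj|nDj] := boolP (x \in dcoset j).
  rewrite (bigD1 x) //= eqxx big1 ?addr0 // => y /andP[_ ne].
  by rewrite (negPf ne).
rewrite big1 // => y Dy; case: eqP => // yx; by rewrite -yx Dy in nDj.
Qed.

Lemma dcoset_mx_sum (J : finType) (c : J -> F) (f : J -> G -> F) :
  dcoset_mx (fun s => \sum_k c k * f k s) = \sum_k c k *: dcoset_mx (f k).
Proof.
apply/matrixP => i j; rewrite summxE mxE.
under eq_bigr do rewrite exchange_big /=.
rewrite exchange_big mulr_sumr; apply: eq_bigr => k _; rewrite !mxE mulrCA.
congr (_ * _); rewrite mulr_sumr; apply: eq_bigr => x _.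
by rewrite mulr_sumr.
Qed.

Lemma dcoset_mx_adjoint f (i j : I) :
  #|dcoset i|%:R * dcoset_mx f i j =
  #|dcoset j|%:R * dcoset_mx (fun s => f s^-1%g) j i.
Proof.
rewrite !mxE !mulrA !mulfV ?card_dcoset_neq0 // !mul1r exchange_big /=.
by do 2!apply: eq_bigr => ? _; rewrite invMg invgK.
Qed.

Lemma dcoset_mx_row_sum f i :
  class_fun f -> \sum_j dcoset_mx f i j = \sum_s f s.
Proof.
move=> cf; have [x Dx] := dcoset_neq0 i.
rewrite (eq_bigr (fun j => \sum_(y in dcoset j) f (y * x^-1)%g)); last first.
  by move=> j _; rewrite (dcoset_mxE _ cf Dx).
rewrite -(sum_dcosets (fun y => f (y * x^-1)%g)) (reindex_inj (mulIg x)) /=.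
by apply: eq_bigr => y _; rewrite mulgK.
Qed.

(** The left-hand sum does not depend on the choice of x in D_i, so it may be
    averaged over x, and each translation y |-> h y k permutes D_i. *)
Lemma sum_double_translates (i : I) (f : G -> F) x : x \in dcoset i ->
  #|dcoset i|%:R * \sum_(h in H) \sum_(k in K) f (h * x * k)%g =
  (#|H|%:R * #|K|%:R) * \sum_(y in dcoset i) f y.
Proof.
move=> Dx; pose g x := \sum_(h in H) \sum_(k in K) f (h * x * k)%g.
transitivity (\sum_(y in dcoset i) g y).
  rewrite mulr_natl -sumr_const; apply: eq_bigr => y.
  rewrite (dcosetE Dx) => /mem_dcosetP[h [k [Hh Kk ->]]].
  rewrite /g [LHS](reindex_inj (mulIg h)) /=.
  apply: eq_big => [h'|h' _]; first by rewrite groupMr.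
  rewrite [LHS](reindex_inj (mulgI k)) /=.
  by apply: eq_big => [k'|k' _]; rewrite ?groupMl // !mulgA.
rewrite exchange_big -mulrA [RHS]mulr_natl -sumr_const; apply: eq_bigr => h Hh.
rewrite exchange_big [RHS]mulr_natl -sumr_const; apply: eq_bigr => k Kk.
exact: sum_dcosetM.
Qed.

Lemma mxtrace_dcoset_mx f :
  \tr (dcoset_mx f) =
  (#|H|%:R * #|K|%:R)^-1 * \sum_(h in H) \sum_(k in K) \sum_x f (h * k ^ x)%g.
Proof.
have HK0 : #|H|%:R * #|K|%:R != 0 :> F.
  by rewrite -natrM pnatr_eq0 -lt0n muln_gt0 !cardG_gt0.
transitivity ((#|H|%:R * #|K|%:R)^-1 *
   \sum_x \sum_(h in H) \sum_(k in K) f (h * x * k * x^-1)%g).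
  rewrite (sum_dcosets (fun x => \sum_(h in H) \sum_(k in K) _)) mulr_sumr.
  apply: eq_bigr => i _; rewrite mxE !mulr_sumr; apply: eq_bigr => x Dx.
  apply: (mulfI (card_dcoset_neq0 i)); apply: (mulfI HK0).
  rewrite mulVKf ?card_dcoset_neq0 //.
  rewrite -(sum_double_translates (fun y => f (y * x^-1)%g) Dx).
  by rewrite [RHS]mulrCA mulVKf.
congr (_ * _); rewrite exchange_big; apply: eq_bigr => h _.
rewrite exchange_big; apply: eq_bigr => k _.
rewrite (reindex_inj invg_inj) /=; apply: eq_bigr => x _.
by rewrite conjgE invgK !mulgA.
Qed.

End Matrix.
End DC.

(** * The induced process *)

Section Lump.
Variables (R : realType) (G : finGroupType) (H K : {group G}).
Local Notation I := (dcoset_space H K).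

Lemma big_tuple_cons (T : finType) n (p : pred (seq T)) (F : seq T -> R) :
  \sum_(w : n.+1.-tuple T | p w) F w =
  \sum_x \sum_(w : n.-tuple T | p (x :: w)) F (x :: w).
Proof.
rewrite pair_big_dep /=.
rewrite (reindex (fun u : T * n.-tuple T => [tuple of u.1 :: u.2])) /=;
    last first.
  exists (fun w : n.+1.-tuple T => (thead w, [tuple of behead w]))
    => [[x w] _|w _] /=.
    by congr pair; apply: val_inj.
  by rewrite [RHS]tuple_eta.
by apply: eq_bigl.
Qed.

Definition path_prob (P : I -> I -> R) :=
  fix path_prob i s := if s is j :: s' then P i j * path_prob j s' else 1.

Lemma path_prob_rcons P i s j :
  path_prob P i (rcons s j) = path_prob P i s * P (last i s) j.
Proof. by elim: s i => [|k s IHs] i /=; rewrite ?mulr1 ?mul1r // IHs mulrA. Qed.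

(** Started at any x in D_i, the walk visits the double cosets listed in s with a
    probability that depends only on i, by induction on s from the front. *)
Lemma induced_law_cons (mu Q : G -> R) (P : 'M[R]_#|dcosets H K|) i s :
  (forall i j x, x \in dcoset i ->
     P i j = \sum_(y in dcoset j) Q (y * x^-1)%g) ->
  induced_law mu Q (i :: s) = (\sum_(x in dcoset i) mu x) * path_prob P i s.
Proof.
move=> PE.
have steps (j : I) x : x \in dcoset j ->
    \sum_(w : (size s).-tuple G | all2 (fun x i => x \in dcoset i) w s)
      walk_steps Q x w = path_prob P j s.
  elim: s j x => [|k s IHs] j x Dx /=.
    rewrite (big_pred1 [tuple]) // => w; rewrite tuple0 /=.
    by rewrite eqxx.
  rewrite (big_tuple_cons _ (fun w => all2 _ w (k :: s)) (walk_steps Q x)) /=.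
  rewrite (PE _ _ _ Dx) mulr_suml [RHS]big_mkcond /=; apply: eq_bigr => y _.
  case: ifP => Dy; last by rewrite big_pred0.
  by rewrite -mulr_sumr (IHs k).
rewrite /induced_law /=.
rewrite (big_tuple_cons _ (fun w => all2 _ w (i :: s)) (walk_law mu Q)) /=.
rewrite mulr_suml [RHS]big_mkcond /=; apply: eq_bigr => x _.
case: ifP => Dx; last by rewrite big_pred0.
by rewrite -mulr_sumr (steps i).
Qed.

Lemma induced_markov (mu Q : G -> R) : is_prob Q -> class_fun Q ->
  markov_chain (induced_law mu Q) (dcoset_mx H K Q).
Proof.
move=> [Q0 Q1] cQ; split=> [i|s x y law0].
  split=> [j|]; last by rewrite dcoset_mx_row_sum.
  rewrite mxE mulr_ge0 ?invr_ge0 ?ler0n //.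
  by do 2!apply: sumr_ge0 => ? _.
have PE i j z : z \in dcoset i ->
    dcoset_mx H K Q i j = \sum_(t in dcoset j) Q (t * z^-1)%g.
  exact: dcoset_mxE.
case: s law0 => [|i s] /=.
  rewrite !(induced_law_cons _ _ _ PE) /= !mulr1 => law0.
  by rewrite mulrAC mulfV ?mul1r ?gt_eqF.
rewrite !(induced_law_cons _ _ _ PE) => law0.
rewrite path_prob_rcons last_rcons mulrA mulrAC mulfV ?mul1r //.
by rewrite gt_eqF.
Qed.

Lemma dcoset_stationary (Q : G -> R) : is_prob Q ->
  stationary (@dcoset_pi R G H K) (dcoset_mx H K Q).
Proof.
move=> [Q0 Q1]; have G0 : #|G|%:R != 0 :> R.
  by rewrite pnatr_eq0 -lt0n; apply/card_gt0P; exists 1%g.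
split; first split=> [i|].
- by rewrite /dcoset_pi divr_ge0 ?ler0n.
- rewrite -mulr_suml -natr_sum; have -> : (\sum_i #|@dcoset G H K i| = #|G|)%N.
    rewrite -[RHS]sum1_card (sum_dcosets H K (fun=> 1%N)).
    by apply: eq_bigr => i _; rewrite sum1_card.
  by rewrite divff.
move=> j; rewrite /dcoset_pi.
transitivity (#|G|%:R^-1 * \sum_(y in dcoset j) \sum_x Q (y * x^-1)%g).
  rewrite exchange_big (sum_dcosets H K (fun x => \sum_(y in dcoset j) _)).
  rewrite mulr_sumr; apply: eq_bigr => i _.
  by rewrite mxE mulrAC mulrA mulfV ?card_dcoset_neq0 // mul1r mulrC.
rewrite (eq_bigr (fun=> 1)) ?sumr_const 1?mulrC // => y _.
have inj : injective (fun x => y * x^-1)%g by move=> a b /mulgI/invg_inj.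
by rewrite -Q1 [RHS](reindex_inj inj).
Qed.

End Lump.

(** * The idempotents attached to irreducible representations *)

Section IdemConv.
Variables (C : numClosedFieldType) (G : finGroupType) (sG : irrType C [set: G]).
Variables (H K : {group G}).
Implicit Types i j : sG.

Lemma mxtrace_irrJ i s t : \tr (irr_repr i (s ^ t)%g) = \tr (irr_repr i s).
Proof.
rewrite conjgE !repr_mxM ?in_setT // mxtrace_mulC -mulmxA.
by rewrite -repr_mxM ?in_setT // mulgV repr_mx1 mulmx1.
Qed.

Lemma irr_idem_class i : class_fun (irr_idem i).
Proof. by move=> s t; rewrite /irr_idem -conjVg mxtrace_irrJ. Qed.

(** Up to the factor n_i / |G|, the convolution at t is the trace of rho_i (t^-1)
    times the operator by which f acts in rho_i. *)
Lemma conv_irr_idem (f : G -> C) i c :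
  \sum_(s in [set: G]) f s *: irr_repr i s = c%:M ->
  conv f (irr_idem i) =1 fun t => c * irr_idem i t.
Proof.
move=> fi t.
have -> : c * irr_idem i t = (irr_degree i)%:R / #|[set: G]|%:R *
    \tr (irr_repr i t^-1%g *m \sum_(s in [set: G]) f s *: irr_repr i s).
  by rewrite fi mul_mx_scalar mxtraceZ /irr_idem mulrCA.
rewrite mulmx_sumr raddf_sum mulr_sumr /conv.
have inj : injective (fun s => s^-1 * t)%g by move=> a b /mulIg/invg_inj.
rewrite (reindex_inj inj) /=.
apply: eq_big => [s|s _]; first by rewrite in_setT.
rewrite invMg invgK mulKVg.
rewrite /irr_idem mulrCA; congr (_ * _).
by rewrite -scalemxAr mxtraceZ invMg invgK repr_mxM ?in_setT.
Qed.

(** The scalar by which the class function f acts in the representation i. *)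
Definition central_value (f : G -> C) i : C :=
  (\sum_s f s * \tr (irr_repr i s)) / (irr_degree i)%:R.

Lemma central_valueV (f : G -> C) i : (forall s, f s \is Num.real) ->
  central_value (fun s => f s^-1%g) i = (central_value f i)^*.
Proof.
move=> fR; rewrite /central_value rmorphM fmorphV rmorph_nat rmorph_sum.
congr (_ / _); rewrite (reindex_inj invg_inj) /=; apply: eq_bigr => s _.
by rewrite rmorphM invgK mxtrace_reprV ?in_setT //= (conj_Creal (fR s)).
Qed.

Lemma central_valueP (f : G -> C) i : class_fun f ->
  \sum_(s in [set: G]) f s *: irr_repr i s = (central_value f i)%:M.
Proof.
move=> cf; rewrite class_sum_scalar //; last exact: socle_irr.
by congr (_ / _)%:M; apply: eq_bigl => s; rewrite in_setT.
Qed.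

Lemma eq_dcoset_mx (F : numFieldType) (f g : G -> F) :
  f =1 g -> dcoset_mx H K f = dcoset_mx H K g.
Proof.
move=> fg; apply/matrixP => i j; rewrite !mxE; congr (_ * _).
by do 2!apply: eq_bigr => ? _.
Qed.

(** The projection of the functions on H\G/K onto the part that comes from i. *)
Definition irr_proj i := dcoset_mx H K (irr_idem i).

Lemma dcoset_mxZ (F : numFieldType) c (f : G -> F) :
  dcoset_mx H K (fun s => c * f s) = c *: dcoset_mx H K f.
Proof.
apply/matrixP => i j; rewrite !mxE mulrCA; congr (_ * _).
by rewrite mulr_sumr; apply: eq_bigr => x _; rewrite mulr_sumr.
Qed.

Lemma irr_proj_mul (f : G -> C) i c : class_fun f ->
  \sum_(s in [set: G]) f s *: irr_repr i s = c%:M ->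
  irr_proj i *m dcoset_mx H K f = c *: irr_proj i.
Proof.
move=> cf fi; rewrite dcoset_mxM //; last exact: irr_idem_class.
by rewrite (eq_dcoset_mx (conv_irr_idem fi)) dcoset_mxZ.
Qed.

(** Orthogonality holds because e_j acts in rho_i as 1 if i = j and as 0
    otherwise; the e_i add up to the unit of the group algebra because the regular
    character is |G| times its indicator. *)
Lemma irr_proj_resolution : spectral_resolution irr_proj.
Proof.
split=> [i j|].
  rewrite (irr_proj_mul (irr_idem_class j) (irr_idem_op j i)) eq_sym.
  by case: eqP => _; rewrite ?scale1r ?scale0r.
rewrite -(dcoset_mx_delta H K C) -[LHS](eq_bigr _ (fun i _ => scale1r _)).
rewrite -dcoset_mx_sum; apply: eq_dcoset_mx => s.
under eq_bigr do rewrite mul1r /irr_idem mulrAC.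
rewrite -mulr_suml sum_irr_regular ?in_setT // eq_invg1 mulrb.
by case: eqP => _; rewrite ?mul0r ?mulfV // card_group_neq0.
Qed.

Lemma dcoset_mx_spectral (f : G -> C) : class_fun f ->
  dcoset_mx H K f = \sum_i central_value f i *: irr_proj i.
Proof.
move=> cf; rewrite -[LHS]mul1mx -(proj2 irr_proj_resolution) mulmx_suml.
by apply: eq_bigr => i _; rewrite (irr_proj_mul cf (central_valueP i cf)).
Qed.

(** In the trace formula, the sum over x of chi_i (h^-1 (k^-1)^x) is, by Schur's
    lemma, |G| / n_i times chi_i (h^-1) chi_i (k^-1); the factor cancels the one
    in e_i. *)
Lemma mxtrace_irr_proj i :
  \tr (irr_proj i) = (#|H|%:R^-1 * \sum_(h in H) \tr (irr_repr i h)) *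
                     (#|K|%:R^-1 * \sum_(k in K) \tr (irr_repr i k)).
Proof.
have sumV (L : {group G}) :
    \sum_(h in L) \tr (irr_repr i h^-1%g) = \sum_(h in L) \tr (irr_repr i h).
  rewrite [RHS](reindex_inj invg_inj) /=.
  by apply: eq_bigl => h; rewrite groupV.
have n0 : (irr_degree i)%:R != 0 :> C by rewrite pnatr_eq0 -lt0n irr_degree_gt0.
rewrite mxtrace_dcoset_mx mulrACA -invfM -!sumV big_distrlr /=; congr (_ * _).
apply: eq_bigr => h _; apply: eq_bigr => k _.
transitivity (\sum_(x in [set: G]) (irr_degree i)%:R / #|[set: G]|%:R *
    \tr (irr_repr i (h^-1 * (k^-1) ^ x)%g)).
  apply: eq_big => [x|x _]; first by rewrite in_setT.
  rewrite /irr_idem invMg conjVg; congr (_ * _).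
  by rewrite !repr_mxM ?in_setT // mxtrace_mulC.
rewrite -mulr_sumr trace_class_average ?in_setT //; last exact: socle_irr.
have N0 := card_group_neq0 C [set: G]; by field; rewrite n0.
Qed.

End IdemConv.

(** * Total variation and the adjoint kernel *)

Section L2.
Variable R : realType.

(** With u = |q - p| / p, the bound says that the variance of u under p is
    nonnegative: m, the p-mean of u, is the L^1 distance between q and p. *)
Lemma chi2_bound (T : finType) (p q : T -> R) :
  (forall t, 0 < p t) -> \sum_t p t = 1 -> \sum_t q t = 1 ->
  tv_dist q p ^+ 2 <= 4^-1 * (\sum_t q t ^+ 2 / p t - 1).
Proof.
move=> p0 p1 q1.
pose u t := `|q t - p t| / p t; pose m := \sum_t p t * u t.
have mE : m = \sum_t `|q t - p t|.
  by apply: eq_bigr => t _; rewrite /u mulrC divfK // gt_eqF.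
have var : \sum_t p t * u t ^+ 2 = \sum_t q t ^+ 2 / p t - 1.
  transitivity (\sum_t (q t ^+ 2 / p t - (q t *+ 2 - p t))); last first.
    by rewrite sumrB sumrB sumrMnl q1 p1 mulr2n addrK.
  apply: eq_bigr => t _; rewrite /u expr_div_n real_normK ?num_real //.
  have pt0 : p t != 0 by rewrite gt_eqF.
  by field.
have : 0 <= \sum_t p t * (u t - m) ^+ 2.
  by apply: sumr_ge0 => t _; rewrite mulr_ge0 ?sqr_ge0 // ltW.
have -> : \sum_t p t * (u t - m) ^+ 2 = \sum_t p t * u t ^+ 2 - m ^+ 2.
  transitivity (\sum_t (p t * u t ^+ 2 - (p t * u t) * m *+ 2 + p t * m ^+ 2)).
    by apply: eq_bigr => t _; ring.
  rewrite big_split /= sumrB sumrMnl -!mulr_suml p1 mul1r -/m -expr2 mulr2n.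
  by rewrite opprD addrA addrNK.
rewrite subr_ge0 var mE => le_m.
have half2 : 2^-1 ^+ 2 = 4^-1 :> R by field.
by rewrite /tv_dist exprMn half2 ler_pM2l // invr_gt0 ltr0n.
Qed.

Lemma stochastic_exp n (A : 'M[R]_n) l :
  (forall i, \sum_j A i j = 1) -> forall i, \sum_j (A ^+ l) i j = 1.
Proof.
move=> A1; elim: l => [|l IHl] i.
  rewrite expr0 (bigD1 i) //= mxE eqxx big1 ?addr0 // => j ne.
  by rewrite mxE eq_sym (negPf ne).
rewrite exprS -[RHS](A1 i).
transitivity (\sum_j \sum_k A i k * (A ^+ l) k j).
  by apply: eq_bigr => j _; rewrite [LHS]mxE.
by rewrite exchange_big; apply: eq_bigr => k _; rewrite -mulr_sumr IHl mulr1.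
Qed.

Lemma adjoint_exp n (p : 'I_n -> R) (A B : 'M[R]_n) l :
  (forall i j, p i * A i j = p j * B j i) ->
  forall i j, p i * (A ^+ l) i j = p j * (B ^+ l) j i.
Proof.
move=> AB; elim: l => [|l IHl] i j.
  rewrite !expr0 !mxE eq_sym; case: eqP => [->//|_]; by rewrite !mulr0.
have -> : (A ^+ l.+1) i j = \sum_k (A ^+ l) i k * A k j.
  by rewrite exprSr [LHS]mxE.
have -> : (B ^+ l.+1) j i = \sum_k B j k * (B ^+ l) k i.
  by rewrite exprS [LHS]mxE.
rewrite !mulr_sumr; apply: eq_bigr => k _.
by rewrite mulrA IHl mulrAC AB -!mulrA; congr (_ * _); rewrite mulrC.
Qed.

(** Averaging the chi-square distances against p, adjointness turns
    p_i A_ij^2 / p_j into A_ij B_ji. *)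
Lemma avg_tv_bound n (p : 'I_n -> R) (A B : 'M[R]_n) :
  (forall i, 0 < p i) -> \sum_i p i = 1 -> (forall i, \sum_j A i j = 1) ->
  (forall i j, p i * A i j = p j * B j i) ->
  \sum_i p i * tv_dist (A i) p ^+ 2 <= 4^-1 * (\tr (A *m B) - 1).
Proof.
move=> p0 p1 A1 AB.
apply: (@le_trans _ _ (\sum_i p i * (4^-1 * (\sum_j A i j ^+ 2 / p j - 1)))).
  by apply: ler_sum => i _; rewrite ler_pM2l //; apply: (chi2_bound (q := A i)).
under eq_bigr do rewrite mulrCA; rewrite -mulr_sumr.
under eq_bigr do rewrite mulrBr mulr1; rewrite sumrB p1.
rewrite le_eqVlt; apply/orP; left; apply/eqP; congr (_ * (_ - 1)).
apply: eq_bigr => i _; rewrite mxE mulr_sumr; apply: eq_bigr => j _.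
by rewrite mulrA expr2 mulrA AB mulrAC [p j * _]mulrC mulfK ?gt_eqF // mulrC.
Qed.

End L2.

Local Open Scope complex_scope.

(** * Spectrum of the induced chain *)

Section Final.
Variables (R : realType) (G : finGroupType) (H K : {group G}).
Local Notation sG := (irreps R [set: G]).

Lemma map_dcoset_mx (f : G -> R) :
  complex_mx (dcoset_mx H K f) = dcoset_mx H K (fun s => (f s)%:C).
Proof.
apply/matrixP => i j; rewrite !mxE rmorphM fmorphV rmorph_nat; congr (_ * _).
by rewrite !rmorph_sum; apply: eq_bigr => x _; rewrite rmorph_sum.
Qed.

Lemma mxtrace_irr_proj_mult (lambda : sG) :
  \tr (irr_proj H K lambda) = (m_mult H K lambda)%:R.
Proof. by rewrite natrM !triv_mult_average mxtrace_irr_proj. Qed.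

Lemma chi1E (lambda : sG) : chi lambda 1%g = (irr_degree lambda)%:R.
Proof. by rewrite /chi repr_mx1 mxtrace1. Qed.

Lemma central_value_uniform (Q : G -> R) (c : G) (lambda : sG) :
  (forall s : G, Q s =
     if s \in (c ^: [set: G])%g then #|(c ^: [set: G])%g|%:R^-1 else 0) ->
  central_value (fun s => (Q s)%:C) lambda = chi_ratio lambda c.
Proof.
move=> Qc; rewrite /central_value /chi_ratio chi1E; congr (_ / _).
have n0 : #|(c ^: [set: G])%g|%:R != 0 :> R[i].
  by rewrite pnatr_eq0 -lt0n; apply/card_gt0P; exists c; apply: class_refl.
rewrite (bigID (fun s => s \in (c ^: [set: G])%g)) /=.
rewrite [X in _ + X]big1 ?addr0 => [|s /negPf sc]; last first.
  by rewrite Qc sc mul0r.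
rewrite (eq_bigr (fun=> #|(c ^: [set: G])%g|%:R^-1 * chi lambda c)) => [|s sc].
  by rewrite sumr_const -mulrnAl -mulr_natr mulVf ?mul1r.
rewrite Qc sc fmorphV rmorph_nat.
suff -> : \tr (irr_repr lambda s) = chi lambda c by [].
by have /imsetP[x _ ->] := sc; rewrite mxtrace_irrJ.
Qed.

Lemma irr1_mult : m_mult H K [1 sG]%irr = 1%N.
Proof.
have avg (L : {group G}) :
    #|L|%:R^-1 * \sum_(x in L) \tr (irr_repr [1 sG]%irr x) = 1 :> R[i].
  rewrite (eq_bigr (fun=> 1)) => [|x _]; last first.
    rewrite irr1_repr ?in_setT ?mxtrace1 ?degree_irr1 //.
  by rewrite sumr_const mulVf // card_group_neq0.
apply/eqP; rewrite -(eqr_nat R[i]) -mxtrace_irr_proj_mult mxtrace_irr_proj.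
by rewrite !avg mulr1.
Qed.

End Final.

Theorem theorem1p2 (R : realType) (G : finGroupType) (H K : {group G})
    (Q : G -> R) (hQ : is_prob Q)
    (hclass : forall s t : G, Q s = Q (t^-1 * s * t)%g) :
  let pi := @dcoset_pi R G H K in
  exists P : 'M[R]_#|dcosets H K|,
    (* the induced process is a Markov chain *)
    (forall mu : G -> R, is_prob mu -> markov_chain (induced_law mu Q) P)
    (* (1) *)
    /\ (forall (i j : dcoset_space H K) (x y : G),
          x \in dcoset i -> y \in dcoset j ->
          P i j = \sum_(s in (H :* y * K :* x^-1)%g) Q s)
    (* (2) *)
    /\ stationary pi P
    (* (3) *)
    /\ ((forall s : G, Q (s^-1)%g = Q s) -> reversible pi P)
    /\ (forall c : G,
          (forall s : G, Q s =
             if s \in (c ^: [set: G])%g then #|(c ^: [set: G])%g|%:R^-1 else 0) ->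
          (* (4) *)
          (forall a : R[i], eigenvalue (complex_mx P) a ->
             exists lambda : irreps R [set: G], a = chi_ratio lambda c)
          (* (5), algebraic and geometric multiplicity *)
          /\ (forall lambda : irreps R [set: G],
                let a := chi_ratio lambda c in
                let m := (\sum_(lambda' : irreps R [set: G]
                             | chi_ratio lambda' c == a) m_mult H K lambda')%N in
                mup a (char_poly (complex_mx P)) = m
                /\ \rank (eigenspace (complex_mx P) a) = m)
          (* (6) *)
          /\ (forall l : nat, (0 < l)%N ->
                (\sum_(i : dcoset_space H K)
                    pi i * tv_dist ((P ^+ l) i) pi ^+ 2)%:C
                <= 4^-1 * \sum_(lambda : irreps R [set: G]
                                | lambda != [1 (irreps R [set: G])]%irr)
                     (m_mult H K lambda)%:R
                     * `|chi_ratio lambda c| ^+ (2 * l))).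
Proof.
move=> pi; have cQ : class_fun Q by move=> s t; rewrite conjgE mulgA -hclass.
exists (dcoset_mx H K Q); split; first by move=> mu _; apply: induced_markov.
split.
  move=> i j x y Dx Dy; rewrite (dcoset_mxE _ cQ Dx) (dcosetE Dy).
  rewrite [RHS](reindex_inj (mulIg x^-1%g)) /=.
  by apply: eq_bigl => z; rewrite mem_rcoset invgK mulgKV.
have statP := dcoset_stationary H K hQ; split=> //.
have adj (f : G -> R) i j : pi i * dcoset_mx H K f i j =
    pi j * dcoset_mx H K (fun s => f s^-1%g) j i.
  by rewrite /pi /dcoset_pi mulrAC dcoset_mx_adjoint mulrAC.
split.
  move=> Qsym i j; rewrite adj; congr (_ * _).
  by rewrite (eq_dcoset_mx H K Qsym).
move=> c Qc.
have cQC : class_fun (fun s => (Q s)%:C) by move=> s t; rewrite cQ.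
have res := irr_proj_resolution (irreps R [set: G]) H K.
have PE : complex_mx (dcoset_mx H K Q) =
    \sum_lambda chi_ratio lambda c *: irr_proj H K lambda.
  rewrite map_dcoset_mx (dcoset_mx_spectral (irreps R [set: G]) H K cQC).
  by apply: eq_bigr => lambda _; rewrite (central_value_uniform _ Qc).
split; last split.
- move=> a; rewrite PE => /(spectral_resolution_eigenvalue res)[lambda _ ->].
  by exists lambda.
- move=> lambda a m; rewrite PE spectral_resolution_mup //.
  suff -> : \rank (eigenspace (\sum_lambda chi_ratio lambda c *:
      irr_proj H K lambda) a) = m by [].
  apply/eqP; rewrite -(eqr_nat R[i]) spectral_resolution_rank // natr_sum.
  by apply/eqP/eq_bigr => mu _; rewrite mxtrace_irr_proj_mult.
move=> l _; set P := dcoset_mx H K Q.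
(* The adjoint of P with respect to pi: the walk driven by s |-> Q (s^-1). *)
pose P' := dcoset_mx H K (fun s => Q s^-1%g).
have [[pi0 pi1] _] := statP.
have pi_gt0 i : 0 < pi i.
  rewrite divr_gt0 ?ltr0n ?card_dcoset_gt0 //; apply/card_gt0P.
  by exists 1%g.
have P1 i : \sum_j P i j = 1 by rewrite dcoset_mx_row_sum //; case: hQ.
have := avg_tv_bound pi_gt0 pi1 (stochastic_exp l P1) (adjoint_exp l (adj Q)).
rewrite -/P -/P' -lecR => /le_trans; apply.
rewrite rmorphM fmorphV rmorph_nat rmorphB rmorph1 ler_pM2l; last first.
  by rewrite invr_gt0 ltr0n.
(* Both sides agree once the trivial representation is moved to the right. *)
rewrite lerBlDl le_eqVlt; apply/orP; left; apply/eqP.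
have P'E : complex_mx P' =
    \sum_lambda (chi_ratio lambda c)^*%R *: irr_proj H K lambda.
  have cQ' : class_fun (fun s => (Q s^-1%g)%:C).
    by move=> s t; rewrite -conjVg cQ.
  rewrite map_dcoset_mx (dcoset_mx_spectral (irreps R [set: G]) H K cQ').
  apply: eq_bigr => lambda _.
  rewrite (central_valueV (f := fun s => (Q s)%:C)) => [|s].
    by rewrite (central_value_uniform _ Qc).
  by apply/complex_realP; exists (Q s).
have mapX (A : 'M[R]_#|dcosets H K|) : complex_mx (A ^+ l) = complex_mx A ^+ l.
  elim: l => [|l IHl]; first by rewrite !expr0 map_mx1.
  by rewrite exprS [LHS](map_mxM _ A (A ^+ l)) IHl exprS.
rewrite -trace_map_mx map_mxM !mapX PE P'E !spectral_resolution_exp //.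
transitivity (\sum_(lambda : irreps R [set: G])
    (m_mult H K lambda)%:R * `|chi_ratio lambda c| ^+ (2 * l)).
  rewrite mulmx_suml raddf_sum; apply: eq_bigr => lambda _.
  rewrite -scalemxAl spectral_resolution_eigen //= !mxtraceZ.
  by rewrite mxtrace_irr_proj_mult mulrA -exprMn -normCK exprM mulrC.
rewrite (bigD1 [1 (irreps R [set: G])]%irr) //=; congr (_ + _).
rewrite irr1_mult mul1r /chi_ratio /chi !irr1_repr ?in_setT //.
by rewrite divff ?normr1 ?expr1n // mxtrace1 pnatr_eq0 -lt0n irr_degree_gt0.
Qed.
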